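(* Let $\lambda$ be a nonzero real number. For every $n \in \mathbb{N}$, \[ H_{n,\lambda}= \sum_{k=1}^n \binom{n}{k} \frac{(-1)^{k-1}}{k} \binom{\lambda+k-1}{k-1}, \] and $H_{0,\lambda}=0$.
   Context: For real $x$ and integer $k\ge 0$, $\binom{x}{k}=\frac{x(x-1)\cdots(x-k+1)}{k!}$. The degenerate harmonic numbers are defined by $H_{0,\lambda}=0$ and $H_{n,\lambda}=\sum_{k=1}^{n}\binom{\lambda-1}{k-1}\frac{(-1)^{k-1}}{k}$ for $n\in\mathbb{N}$ (equivalently $H_{n,\lambda}=\frac{1}{\lambda}\sum_{k=1}^n\binom{\lambda}{k}(-1)^{k-1}$). *)

(* Defs.v *)
From mathcomp Require Import all_boot all_order all_algebra.
From mathcomp Require Import reals.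

Set Implicit Arguments.
Unset Strict Implicit.
Unset Printing Implicit Defensive.

Import Order.TTheory GRing.Theory Num.Theory.

Local Open Scope ring_scope.

Definition rbinom (R : realType) (x : R) (k : nat) : R :=
  (\prod_(i < k) (x - i%:R)) / (k`!)%:R.

(* For n = 0 the sum is empty, which gives the convention H_{0,lambda} = 0. *)
Definition degenerate_harmonic (R : realType) (lambda : R) (n : nat) : R :=
  \sum_(1 <= k < n.+1) rbinom (lambda - 1) k.-1 * ((-1) ^+ k.-1 / k%:R).

(* Main.v *)
(** Both sides vanish at n = 0, so it suffices to compare increments in n.
    By Pascal's rule and [C(n, j) / (j+1) = C(n+1, j+1) / (n+1)], the increment
    of the right-hand side is [1/(n+1)] times the sum over j <= n of
    [C(n+1, j+1) (-1)^j C(lambda+j, j) = C(n+1, n-j) C(-lambda-1, j)],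
    which is [C(n-lambda, n) = (-1)^n C(lambda-1, n)] by Vandermonde's
    convolution. *)
Require Import Defs.
From mathcomp Require Import all_boot all_order all_algebra.
From mathcomp Require Import reals.
From mathcomp Require Import ring.

Import Order.TTheory GRing.Theory Num.Theory.

Local Open Scope ring_scope.

Lemma rbinom0 (R : realType) (x : R) : rbinom x 0 = 1.
Proof. by rewrite /rbinom big_ord0 fact0 divr1. Qed.

Lemma rbinom_pascal (R : realType) (x : R) (k : nat) :
  rbinom (x + 1) k.+1 = rbinom x k.+1 + rbinom x k.
Proof.
rewrite /rbinom big_ord_recl big_ord_recr /= subr0.
(* Since [(x + 1) - (i + 1) = x - i], all three terms share the product over [i < k]; what remains
   is [x + 1 = (x - k) + (k + 1)]. *)
rewrite (eq_bigr (fun i : 'I_k => x - i%:R)) => [|i _]; last first.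
  by rewrite /bump add1n -natr1; ring.
have kfact_neq0 : (k`!)%:R != 0 :> R by rewrite pnatr_eq0 -lt0n fact_gt0.
have k1_neq0 : k%:R + 1 != 0 :> R by rewrite natr1 pnatr_eq0.
by rewrite factS natrM -natr1; field; rewrite kfact_neq0.
Qed.

(** Negate each factor and read the product backwards: [- x - i] is minus the factor of index
    [k - 1 - i] on the right. *)
Lemma rbinomN (R : realType) (x : R) (k : nat) :
  rbinom (- x) k = (-1) ^+ k * rbinom (x + k%:R - 1) k.
Proof.
rewrite /rbinom mulrA; congr (_ / _).
rewrite [in RHS](reindex_inj rev_ord_inj) /= -[in (-1) ^+ k](card_ord k).
rewrite -prodr_const -big_split /=.
by apply: eq_bigr => i _; rewrite natrB // -natr1; ring.
Qed.

(** With one upper argument a natural number, induction on [m] suffices: Pascal's rule splits both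
    ['C(m.+1, j)] and the right-hand side. *)
Lemma rbinom_vandermonde (R : realType) (x : R) (m n : nat) :
  \sum_(j < n.+1) 'C(m, j)%:R * rbinom x (n - j) = rbinom (x + m%:R) n.
Proof.
elim: m n => [|m IHm] n.
  rewrite big_ord_recl big1 => [|i _]; last by rewrite lift0 bin0n mul0r.
  by rewrite bin0 mul1r subn0 !addr0.
case: n => [|n]; first by rewrite big_ord1 bin0 mul1r !rbinom0.
rewrite -natr1 addrA rbinom_pascal -!IHm big_ord_recl [in RHS]big_ord_recl.
rewrite !bin0 -addrA -big_split /=; congr (_ + _).
by apply: eq_bigr => i _; rewrite binS natrD mulrDl.
Qed.

Lemma alternating_sum_rbinom (R : realType) (x : R) (n : nat) :
  \sum_(j < n.+1) 'C(n.+1, j.+1)%:R * (-1) ^+ j * rbinom (x + j%:R) j =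
  (-1) ^+ n * rbinom (x - 1) n.
Proof.
transitivity (rbinom (- (x + 1) + n.+1%:R) n).
  rewrite -rbinom_vandermonde [RHS](reindex_inj rev_ord_inj) /=.
  apply: eq_bigr => j _; have le_jn : (j <= n)%N by rewrite -ltnS.
  rewrite subSS subKn // rbinomN -subSS bin_sub // -mulrA.
  by congr (_ * (_ * rbinom _ _)); ring.
(* A second reflection turns the upper argument [n - x] into [(x - n) + n - 1 = x - 1]. *)
have -> : - (x + 1) + n.+1%:R = - (x - n%:R) by rewrite -natr1; ring.
by rewrite rbinomN; congr (_ * rbinom _ _); ring.
Qed.

Lemma degenerate_harmonic_binomial_sum (R : realType) (lambda : R) (n : nat) :
  degenerate_harmonic lambda n =
    \sum_(1 <= k < n.+1)
       'C(n, k)%:R * ((-1) ^+ k.-1 / k%:R) * rbinom (lambda + k%:R - 1) k.-1.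
Proof.
rewrite /degenerate_harmonic !big_add1 /= !big_mkord.
elim: n => [|n IHn]; first by rewrite !big_ord0.
under [RHS]eq_bigr => k _ do rewrite binS natrD !mulrDl.
rewrite big_split big_ord_recr /= IHn; congr (_ + _).
  (* The extra last term carries ['C(n, n.+1) = 0]. *)
  by rewrite big_ord_recr /= bin_small // !mul0r addr0.
rewrite mulrA [_ * (-1) ^+ n]mulrC -alternating_sum_rbinom mulr_suml.
apply: eq_bigr => j _.
have -> : lambda + j.+1%:R - 1 = lambda + j%:R by rewrite -natr1; ring.
have n1_neq0 : n.+1%:R != 0 :> R by rewrite pnatr_eq0.
have j1_neq0 : j.+1%:R != 0 :> R by rewrite pnatr_eq0.
(* Absorption trades the denominator [j + 1] for [n + 1], which is constant over the sum. *)
have bin_diag : 'C(n, j)%:R / j.+1%:R = 'C(n.+1, j.+1)%:R / n.+1%:R :> R.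
  apply/eqP; rewrite eqr_div // -!natrM; apply/eqP; congr _%:R.
  by rewrite mulnC mul_bin_diag mulnC.
by rewrite ['C(n, j)%:R * _]mulrCA bin_diag; ring.
Qed.

Theorem theorem2p1 (R : realType) (lambda : R) (lambda_neq0 : lambda != 0) :
  (forall n : nat, (1 <= n)%N ->
     degenerate_harmonic lambda n =
       \sum_(1 <= k < n.+1)
          'C(n, k)%:R * ((-1) ^+ k.-1 / k%:R)
            * rbinom (lambda + k%:R - 1) k.-1)
  /\ degenerate_harmonic lambda 0 = 0.
Proof.
split=> [n _|]; first exact: degenerate_harmonic_binomial_sum.
by rewrite /degenerate_harmonic big_geq.
Qed.
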